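(* Let $G$ be a Lie group, let $(X,p,B)$ be a smooth principal $G$-bundle, let $F$ be a smooth manifold with a smooth left action of $G$, and let $((X\times F)/G,p_F,B)$ be the associated smooth fiber bundle. Then the smooth cross sections $s$ of $p_F\colon(X\times F)/G\to B$ are in bijective correspondence with the smooth $G$-equivariant maps $\phi\colon X\to F$, via the mutually inverse assignments $\phi\mapsto s_\phi$ and $s\mapsto\phi_s$, where $s_\phi(p(x))=(x,\phi(x))\cdot G$ and $\phi_s$ is determined by $s(p(x))=(x,\phi_s(x))\cdot G$ for all $x\in X$.
   Context: Smooth manifolds are Hausdorff and second countable. A smooth principal $G$-bundle $(X,p,B)$ consists of smooth manifolds $X,B$, a smooth surjective map $p\colon X\to B$, a smooth right action of $G$ on $X$, and an open cover $\{U_i\}$ of $B$ with diffeomorphisms $\psi_i\colon U_i\times G\to p^{-1}(U_i)$ such that $p\circ\psi_i$ is the projection on the first factor and $\psi_i(b,gh)=\psi_i(b,g)\cdot h$ for $b\in U_i$, $g,h\in G$. Then the action of $G$ on $X$ is free and proper and the fibers of $p$ are the orbits. $G$ acts on $X\times F$ on the right by $(x,y)\cdot g=(x\cdot g,g^{-1}\cdot y)$, freely and properly; the orbit space $(X\times F)/G$ carries the unique smooth structure for which the quotient map $X\times F\to(X\times F)/G$ is a submersion, and $p_F((x,y)\cdot G)=p(x)$. A cross section is a map $s\colon B\to(X\times F)/G$ with $p_F\circ s=\mathrm{id}_B$. A map $\phi\colon X\to F$ is $G$-equivariant if $\phi(x\cdot g)=g^{-1}\cdot\phi(x)$ for all $x\in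 X$, $g\in G$. *)

(* Defs.v *)
From HB Require Import structures.
From mathcomp Require Import all_boot all_order all_algebra.
From mathcomp Require Import all_classical all_reals all_analysis.

Set Implicit Arguments.
Unset Strict Implicit.
Unset Printing Implicit Defensive.

Import Order.TTheory GRing.Theory Num.Theory.
Import numFieldNormedType.Exports.
Local Open Scope classical_set_scope.
Local Open Scope ring_scope.
Local Open Scope quotient_scope.

Section smooth_euclidean.
Context {R : realType}.

(* [U] is meant to be open; [f] is total, but its values outside [U] are
   irrelevant. As Hom(R^n, R^m) is finite-dimensional, [f] is C^(k+1) iff it is
   differentiable with [fun x => 'd f x v] of class C^k for every vector [v]. *)
Fixpoint Ck (k : nat) n m (U : set 'rV[R]_n) (f : 'rV[R]_n -> 'rV[R]_m)
    : Prop :=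
  match k with
  | 0 => forall x, U x -> {for x, continuous f}
  | k'.+1 => (forall x, U x -> differentiable f x) /\
             forall v, Ck k' U (fun x => 'd f x v)
  end.

Definition Cinfty n m (U : set 'rV[R]_n) (f : 'rV[R]_n -> 'rV[R]_m) : Prop :=
  forall k, Ck k U f.

Lemma Ck_sub k n m (U V : set 'rV[R]_n) (f : 'rV[R]_n -> 'rV[R]_m) :
  V `<=` U -> Ck k U f -> Ck k V f.
Proof.
move=> VU; elim: k f => [|k IHk] f /=; first by move=> cf x /VU; exact: cf.
by move=> [df cf]; split=> [x /VU|v]; [exact: df|exact/IHk/cf].
Qed.

Lemma differentiable_near0 n m (h : 'rV[R]_n -> 'rV[R]_m) x :
  (\near x, h x = 0) -> differentiable h x /\ 'd h x = 0 :> (_ -> _).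
Proof.
move=> h0; have hx0 : h x = 0 by exact: nbhs_singleton h0.
have hE : h \o shift x = cst (h x) + (\0 : _ -> _) +o_ 0 id.
  apply/eqaddoP => e e0.
  have : \forall y \near (0 : 'rV[R]_n), h (y + x) = 0.
    by rewrite (near_shift x); apply: filterS h0 => y; rewrite /= sub0r subrK.
  apply: filterS => y /= hy.
  by rewrite !fctE /= hy hx0 addr0 subr0 normr0 mulr_ge0// ltW.
have c0 : continuous (\0 : 'rV[R]_n -> 'rV[R]_m).
  by move=> y; exact: cst_continuous.
have dh : 'd h x = (\0 : {linear 'rV[R]_n -> 'rV[R]_m}) :> (_ -> _).
  exact: diff_unique.
by split=> //; apply/diff_locallyP; rewrite dh.
Qed.

Lemma differentiable_eq_near n m (f g : 'rV[R]_n -> 'rV[R]_m) x :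
  (\near x, f x = g x) -> differentiable f x ->
  differentiable g x /\ 'd g x = 'd f x :> (_ -> _).
Proof.
move=> fg df.
have [dh hE] : differentiable (g - f) x /\ 'd (g - f) x = 0 :> (_ -> _).
  apply: differentiable_near0; apply: filterS fg => y fgy.
  by rewrite !fctE fgy subrr.
have -> : g = f + (g - f) by rewrite addrC subrK.
split; first exact: differentiableD.
apply: (etrans (diffD df dh)); apply/funext => v.
have hEv := congr1 (fun L => L v) hE.
apply: (etrans (congr1 (fun w => 'd f x v + w) hEv)).
exact: addr0.
Qed.

Lemma Ck_ext k n m (U : set 'rV[R]_n) (f g : 'rV[R]_n -> 'rV[R]_m) :
  open U -> (forall x, U x -> f x = g x) -> Ck k U f -> Ck k U g.
Proof.
move=> oU; elim: k f g => [|k IHk] f g fg /=.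
  move=> cf x Ux; change (g @ x --> g x); rewrite -fg//.
  apply: cvg_trans (cf x Ux).
  apply: (@near_eq_cvg _ _ (nbhs x) (nbhs_filter x)).
  by apply: filterS (open_nbhs_nbhs (conj oU Ux)) => y Uy; exact: fg.
have fgx x : U x -> \near x, f x = g x.
  by move=> Ux; apply: filterS (open_nbhs_nbhs (conj oU Ux)) => y Uy; exact: fg.
move=> [df cf]; split=> [x Ux|v].
  by have [] := differentiable_eq_near (fgx x Ux) (df x Ux).
apply: IHk (cf v) => x Ux.
have [_ E] := differentiable_eq_near (fgx x Ux) (df x Ux).
exact: esym (congr1 (fun L => L v) E).
Qed.

Lemma CkD k n m (U : set 'rV[R]_n) (f g : 'rV[R]_n -> 'rV[R]_m) :
  open U -> Ck k U f -> Ck k U g -> Ck k U (f \+ g).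
Proof.
move=> oU; elim: k f g => [|k IHk] f g /= cf cg.
  by move=> x Ux; apply: continuousD; [exact: cf|exact: cg].
have [df {}cf] := cf; have [dg {}cg] := cg; split=> [x Ux|v].
  by apply: differentiableD; [exact: df|exact: dg].
apply: Ck_ext (IHk _ _ (cf v) (cg v)) => // x Ux.
exact: esym (congr1 (fun L => L v) (diffD (df x Ux) (dg x Ux))).
Qed.

Lemma Ck_linl k n m p (U : set 'rV[R]_n) (f : 'rV[R]_n -> 'rV[R]_m)
    (L : {linear 'rV[R]_m -> 'rV[R]_p}) :
  continuous L -> open U -> Ck k U f -> Ck k U (L \o f).
Proof.
move=> cL oU; elim: k f => [|k IHk] f /= cf.
  by move=> x Ux; apply: continuous_comp; [exact: cf|exact: cL].
have [df {}cf] := cf; split=> [x Ux|v].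
  by apply: differentiable_comp; [exact: df|exact: linear_differentiable].
apply: Ck_ext (IHk _ (cf v)) => // x Ux.
have dL : differentiable L (f x) by exact: linear_differentiable.
apply: esym (etrans (congr1 (fun h => h v) (diff_comp (df x Ux) dL)) _).
exact: (congr1 (fun h => h ('d f x v)) (diff_lin (f x) cL)).
Qed.

Lemma Ck_linr k n m p (U : set 'rV[R]_m) (f : 'rV[R]_m -> 'rV[R]_p)
    (L : {linear 'rV[R]_n -> 'rV[R]_m}) :
  continuous L -> open U -> Ck k U f -> Ck k (L @^-1` U) (f \o L).
Proof.
move=> cL oU; elim: k f => [|k IHk] f /= cf.
  by move=> x Ux; apply: continuous_comp; [exact: cL|exact: cf].
have oL : open (L @^-1` U) by apply: open_comp => // x _; exact: cL.
have [df {}cf] := cf; split=> [x Ux|v].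
  by apply: differentiable_comp; [exact: linear_differentiable|exact: df].
apply: Ck_ext (IHk _ (cf (L v))) => // x Ux.
have dL : differentiable L x by exact: linear_differentiable.
apply: esym (etrans (congr1 (fun h => h v) (diff_comp dL (df _ Ux))) _).
exact: (congr1 (fun h => 'd f (L x) (h v)) (diff_lin x cL)).
Qed.

Lemma continuous_row_mx n m :
  continuous (fun z : 'rV[R]_n * 'rV[R]_m => row_mx z.1 z.2).
Proof.
move=> [a b] A /nbhs_ballP[e /= e0 eA].
have : nbhs (a, b) (ball (a, b) e) by exact: nbhsx_ballx.
apply: filterS => -[c d] [/= [_ ac] [_ bd]]; apply: eA; split=> // i j.
by rewrite !mxE; case: (fintype.split j) => k; [exact: ac|exact: bd].
Qed.

Lemma Ck_row_mx k n1 n2 m1 m2 (U : set 'rV[R]_n1) (V : set 'rV[R]_n2)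
    (f : 'rV[R]_n1 -> 'rV[R]_m1) (g : 'rV[R]_n2 -> 'rV[R]_m2) :
  open U -> open V -> Ck k U f -> Ck k V g ->
  Ck k ((lsubmx @^-1` U) `&` (rsubmx @^-1` V) : set 'rV[R]_(n1 + n2))
    (fun v => row_mx (f (lsubmx v)) (g (rsubmx v))).
Proof.
move=> oU oV cf cg.
pose inl (u : 'rV[R]_m1) : 'rV[R]_(m1 + m2) := row_mx u 0.
pose inr (u : 'rV[R]_m2) : 'rV[R]_(m1 + m2) := row_mx 0 u.
have inl_lin : linear inl.
  by move=> a u v; rewrite /inl scale_row_mx add_row_mx scaler0 addr0.
have inr_lin : linear inr.
  by move=> a u v; rewrite /inr scale_row_mx add_row_mx scaler0 addr0.
pose Ll : {linear _ -> _} := HB.pack inl (GRing.isLinear.Build _ _ _ _ _ inl_lin).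
pose Lr : {linear _ -> _} := HB.pack inr (GRing.isLinear.Build _ _ _ _ _ inr_lin).
have cLl : continuous Ll.
  move=> u A /nbhs_ballP[e /= e0 eA].
  have : nbhs u (ball u e) by exact: nbhsx_ballx.
  apply: filterS => v [_ uv]; apply: eA; split=> // a b.
  rewrite /= /inl !mxE; case: (fintype.split b) => c.
    by exact: uv.
  by rewrite mxE; exact: ballxx.
have cLr : continuous Lr.
  move=> u A /nbhs_ballP[e /= e0 eA].
  have : nbhs u (ball u e) by exact: nbhsx_ballx.
  apply: filterS => v [_ uv]; apply: eA; split=> // a b.
  rewrite /= /inr !mxE; case: (fintype.split b) => c.
    by rewrite mxE; exact: ballxx.
  by exact: uv.
have cl := @continuous_lsubmx R 1 n1 n2.
have cr := @continuous_rsubmx R 1 n1 n2.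
have ol : open (lsubmx @^-1` U : set 'rV[R]_(n1 + n2)).
  by apply: open_comp => // x _; exact: cl.
have or : open (rsubmx @^-1` V : set 'rV[R]_(n1 + n2)).
  by apply: open_comp => // x _; exact: cr.
have oI := openI ol or.
apply: (@Ck_ext _ _ _ _
  ((Ll \o (f \o lsubmx)) \+ (Lr \o (g \o rsubmx)))) => // [x _|].
  by rewrite /= /inl /inr add_row_mx addr0 add0r.
by apply: CkD => //; apply: Ck_linl => //;
  [apply: Ck_sub (Ck_linr cl oU cf)|apply: Ck_sub (Ck_linr cr oV cg)] => x [].
Qed.

End smooth_euclidean.

(* A chart is given by total functions in both directions: [cfun] matters on
   [cdom] only, and [cinv] on the image [cimg] only. *)
Record chart (R : realType) (T : topologicalType) (n : nat) := Chart {
  cdom : set T ;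
  cfun : T -> 'rV[R]_n ;
  cinv : 'rV[R]_n -> T ;
  cdom_open : open cdom ;
  cimg_open : open (cfun @` cdom) ;
  cfunK : forall x, cdom x -> cinv (cfun x) = x ;
  cfun_continuous : forall x, cdom x -> {for x, continuous cfun} ;
  cinv_continuous : forall v, (cfun @` cdom) v -> {for v, continuous cinv} }.

Notation cimg c := (cfun c @` cdom c).

(* The atlas is not required to be maximal; the notions below depend only on
   the maximal atlas it generates. *)
Record smoothStructure (R : realType) (T : topologicalType) :=
  SmoothStructure {
  mdim : nat ;
  atlas : set (chart R T mdim) ;
  hausdorffP : hausdorff_space T ;
  second_countableP : @second_countable T ;
  atlas_cover : forall x, exists2 c, atlas c & cdom c x ;
  atlas_compat : forall c d, atlas c -> atlas d ->
    Cinfty (cfun c @` (cdom c `&` cdom d)) (cfun d \o cinv c) }.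
Arguments atlas {R T} s _.

Record manifold (R : realType) := Manifold {
  msort :> topologicalType ;
  mstruct : smoothStructure R msort }.
Arguments Manifold {R msort} mstruct.

Lemma continuous_pair (S T1 T2 : topologicalType) (f : S -> T1) (g : S -> T2)
    s : {for s, continuous f} -> {for s, continuous g} ->
  {for s, continuous (fun s => (f s, g s))}.
Proof.
move=> cf cg A [[P Q] [/= fP gQ] PQA].
have h : nbhs s (f @^-1` P `&` g @^-1` Q).
  by apply: filterI; [exact: cf|exact: cg].
apply: (@filterS _ (nbhs s) _ _ _ _ h) => t [Pt Qt]; exact: PQA.
Qed.

Section product_manifold.
Context {R : realType}.

Section product_chart.
Context {S T : topologicalType} {m n : nat} (c : chart R S m) (d : chart R T n).

Let f (z : S * T) : 'rV[R]_(m + n) := row_mx (cfun c z.1) (cfun d z.2).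
Let g (v : 'rV[R]_(m + n)) : S * T := (cinv c (lsubmx v), cinv d (rsubmx v)).

Let imgE :
  f @` (cdom c `*` cdom d) = lsubmx @^-1` cimg c `&` rsubmx @^-1` cimg d.
Proof.
apply/seteqP; split=> [_ [[x y] [/= cx dy] <-]|v [[x cx xE] [y dy yE]]].
  by split; rewrite /= ?row_mxKl ?row_mxKr; [exists x|exists y].
by exists (x, y) => //=; rewrite /f /= xE yE hsubmxK.
Qed.

Lemma prod_chart_dom_open : open (cdom c `*` cdom d).
Proof.
rewrite openE => -[x y] [/= cx dy]; exists (cdom c, cdom d) => //=.
by split; apply: open_nbhs_nbhs; split=> //; exact: cdom_open.
Qed.

Lemma prod_chart_img_open : open (f @` (cdom c `*` cdom d)).
Proof.
rewrite imgE; apply: openI; apply: open_comp (@cimg_open _ _ _ _) => v _;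
  [exact: continuous_lsubmx|exact: continuous_rsubmx].
Qed.

Lemma prod_chart_funK z : (cdom c `*` cdom d) z -> g (f z) = z.
Proof.
by case: z => x y [/= cx dy]; rewrite /g /f row_mxKl row_mxKr !cfunK.
Qed.

Lemma prod_chart_fun_continuous z :
  (cdom c `*` cdom d) z -> {for z, continuous f}.
Proof.
case: z => x y [/= cx dy].
have h : {for (x, y), continuous (fun z : S * T => (cfun c z.1, cfun d z.2))}.
  apply: continuous_pair.
    apply: (@continuous_comp _ _ _ fst (cfun c)); first exact: cvg_fst.
    exact: cfun_continuous.
  apply: (@continuous_comp _ _ _ snd (cfun d)); first exact: cvg_snd.
  exact: cfun_continuous.
exact: (continuous_comp h (@continuous_row_mx _ _ _ _)).
Qed.

Lemma prod_chart_inv_continuous v :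
  (f @` (cdom c `*` cdom d)) v -> {for v, continuous g}.
Proof.
rewrite imgE => -[/= cv dv]; apply: continuous_pair.
  apply: (@continuous_comp _ _ _ lsubmx (cinv c)).
    exact: continuous_lsubmx.
  exact: cinv_continuous.
apply: (@continuous_comp _ _ _ rsubmx (cinv d)).
  exact: continuous_rsubmx.
exact: cinv_continuous.
Qed.

Definition prod_chart : chart R (S * T)%type (m + n) :=
  Chart prod_chart_dom_open prod_chart_img_open prod_chart_funK
    prod_chart_fun_continuous prod_chart_inv_continuous.

End product_chart.

Context {S T : topologicalType}.
Variables (SS : smoothStructure R S) (ST : smoothStructure R T).

Definition prod_atlas : set (chart R (S * T)%type (mdim SS + mdim ST)) :=
  [set prod_chart c d | c in atlas SS & d in atlas ST].

Lemma prod_hausdorff : hausdorff_space (S * T)%type.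
Proof.
move=> [x1 y1] [x2 y2] cl; congr pair.
  apply: (hausdorffP SS) => A B xA xB.
  have [] := cl (A `*` setT) (B `*` setT).
  - by exists (A, setT) => //=; split=> //; exact: filterT.
  - by exists (B, setT) => //=; split=> //; exact: filterT.
  by move=> [x y] [[/= Ax _] [Bx _]]; exists x.
apply: (hausdorffP ST) => A B yA yB.
have [] := cl (setT `*` A) (setT `*` B).
- by exists (setT, A) => //=; split=> //; exact: filterT.
- by exists (setT, B) => //=; split=> //; exact: filterT.
by move=> [x y] [[/= _ Ay] [_ By]]; exists y.
Qed.

Lemma prod_second_countable : @second_countable (S * T)%type.
Proof.
have [BS cS [oS bS]] := second_countableP SS.
have [BT cT [oT bT]] := second_countableP ST.
exists [set U `*` V | U in BS & V in BT].
  have -> : [set U `*` V | U in BS & V in BT] =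
            (fun p : set S * set T => p.1 `*` p.2) @` (BS `*` BT).
    apply/seteqP; split=> [_ [U BU [V BV <-]]|_ [[U V] [/= BU BV] <-]].
      by exists (U, V).
    by exists U => //; exists V.
  exact: card_le_trans (card_image_le _ _) (countableX cS cT).
split=> [_ [U BU [V BV <-]]|[x y] A [[P Q] [/= xP yQ] PQA]].
  rewrite openE => -[x y] [/= Ux Vy]; exists (U, V) => //=.
  by split; apply: open_nbhs_nbhs; split=> //; [exact: oS|exact: oT].
have [U [BU Ux] UP] := bS x P xP; have [V [BV Vy] VQ] := bT y Q yQ.
exists (U `*` V) => /=.
  by split=> //; exists U => //; exists V.
by move=> [a b] [/= Ua Vb]; apply: PQA; split; [exact: UP|exact: VQ].
Qed.

Lemma prod_atlas_cover z : exists2 c, prod_atlas c & cdom c z.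
Proof.
case: z => x y; have [c ac cx] := atlas_cover SS x.
have [d ad dy] := atlas_cover ST y.
by exists (prod_chart c d) => //; exists c => //; exists d.
Qed.

Lemma transition_dom_open (Z : topologicalType) n (c d : chart R Z n) :
  open (cfun c @` (cdom c `&` cdom d)).
Proof.
have -> : cfun c @` (cdom c `&` cdom d) = cimg c `&` cinv c @^-1` (cdom d).
  apply/seteqP; split=> [_ [x [cx dx] <-]|_ [[x cx <-] /= dx]].
    by split; [exists x|rewrite /= cfunK].
  by exists x => //; split=> //; rewrite -(cfunK cx).
rewrite openE => v [cv dv]; apply: filterI.
  by apply: open_nbhs_nbhs; split=> //; exact: cimg_open.
apply: (cinv_continuous cv); apply: open_nbhs_nbhs; split=> //.
exact: cdom_open.
Qed.

Lemma prod_atlas_compat c d : prod_atlas c -> prod_atlas d ->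
  Cinfty (cfun c @` (cdom c `&` cdom d)) (cfun d \o cinv c).
Proof.
move=> [c1 ac1 [c2 ac2 <-]] [d1 ad1 [d2 ad2 <-]] k /=.
have H := Ck_row_mx (@transition_dom_open _ _ c1 d1)
  (@transition_dom_open _ _ c2 d2)
  (atlas_compat ac1 ad1 k) (atlas_compat ac2 ad2 k).
apply: Ck_sub H => _ [[x y] [[/= c1x c2y] [/= d1x d2y]] <-].
by split; rewrite /= ?row_mxKl ?row_mxKr; [exists x|exists y].
Qed.

Definition prod_smoothStructure : smoothStructure R (S * T)%type :=
  SmoothStructure prod_hausdorff prod_second_countable prod_atlas_cover
    prod_atlas_compat.

End product_manifold.

Definition prod_manifold (R : realType) (M N : manifold R) : manifold R :=
  Manifold (prod_smoothStructure (mstruct M) (mstruct N)).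

Section smooth_maps.
Context {R : realType}.
Implicit Types M N : manifold R.

Definition local_expr M N (c : chart R M (mdim (mstruct M)))
    (d : chart R N (mdim (mstruct N))) (f : M -> N) :=
  cfun d \o f \o cinv c.

(* [U] is meant to be open; [f] is total, but its values outside [U] are
   irrelevant. *)
Definition smooth_on M N (U : set M) (f : M -> N) : Prop :=
  (forall x, U x -> {for x, continuous f}) /\
  forall c d, atlas (mstruct M) c -> atlas (mstruct N) d ->
    Cinfty (cfun c @` (U `&` cdom c `&` f @^-1` cdom d)) (local_expr c d f).

Definition smooth M N (f : M -> N) : Prop := smooth_on setT f.

(* The inverse can be total as soon as [M] is nonempty or [N] is empty. This is
   the case for the trivializations of a principal bundle, since [G] is nonempty
   and the projection is surjective. *)
Definition diffeo_on M N (U : set M) (V : set N) (f : M -> N) : Prop :=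
  exists g : N -> M,
    [/\ (forall x, U x -> V (f x) /\ g (f x) = x),
        (forall y, V y -> U (g y) /\ f (g y) = y),
        smooth_on U f & smooth_on V g].

Definition submersion M N (f : M -> N) : Prop :=
  smooth f /\
  forall x c d, atlas (mstruct M) c -> atlas (mstruct N) d ->
    cdom c x -> cdom d (f x) ->
    forall w, exists v, 'd (local_expr c d f) (cfun c x) v = w.

End smooth_maps.

(* No compatibility between the two structures is imposed here: in a Lie group
   it follows from the smoothness of the operations. *)
#[short(type="topGroupType")]
HB.structure Definition TopGroup := {G of Topological G & Group G}.

Record lieGroup (R : realType) := LieGroup {
  lgsort :> topGroupType ;
  lgstruct : smoothStructure R lgsort ;
  lg_manifold := Manifold lgstruct ;
  lg_mul_smooth :
    @smooth R (prod_manifold lg_manifold lg_manifold) lg_manifold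
      (fun z => z.1 * z.2)%g ;
  lg_inv_smooth : @smooth R lg_manifold lg_manifold (fun g => g^-1)%g }.

Record rightAction (R : realType) (G : lieGroup R) (X : manifold R) :=
  RightAction {
  ract :> X -> G -> X ;
  ract1 : forall x, ract x 1%g = x ;
  ractM : forall x g h, ract x (g * h)%g = ract (ract x g) h ;
  ract_smooth : @smooth R (prod_manifold X (lg_manifold G)) X
    (fun z => ract z.1 z.2) }.

Record leftAction (R : realType) (G : lieGroup R) (F : manifold R) :=
  LeftAction {
  lact :> G -> F -> F ;
  lact1 : forall y, lact 1%g y = y ;
  lactM : forall g h y, lact (g * h)%g y = lact g (lact h y) ;
  lact_smooth : @smooth R (prod_manifold (lg_manifold G) F) F
    (fun z => lact z.1 z.2) }.

Record principalBundle (R : realType) (G : lieGroup R) (X B : manifold R) :=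
  PrincipalBundle {
  pbproj : X -> B ;
  pbproj_smooth : smooth pbproj ;
  pbproj_surj : forall b, exists x, pbproj x = b ;
  pbact : rightAction G X ;
  pbindex : Type ;
  pbcover : pbindex -> set B ;
  pbcover_open : forall i, open (pbcover i) ;
  pbcoverT : \bigcup_i pbcover i = setT ;
  pbtriv : pbindex -> B * G -> X ;
  pbtriv_diffeo : forall i,
    @diffeo_on R (prod_manifold B (lg_manifold G)) X
      (pbcover i `*` setT) (pbproj @^-1` pbcover i) (pbtriv i) ;
  pbtriv_proj : forall i b g, pbcover i b -> pbproj (pbtriv i (b, g)) = b ;
  pbtriv_act : forall i b g h, pbcover i b ->
    pbtriv i (b, (g * h)%g) = pbact (pbtriv i (b, g)) h }.
Arguments pbcover {R G X B} p i.
Arguments pbtriv {R G X B} p i.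
Arguments pbtriv_diffeo {R G X B} p i.

Section associated_bundle.
Context {R : realType} {G : lieGroup R} {X B F : manifold R}.
Variables (P : principalBundle G X B) (a : leftAction G F).

Definition diag_act (z : X * F) (g : G) : X * F := (pbact P z.1 g, a g^-1%g z.2).

Definition Gorbit_rel (z z' : X * F) : bool :=
  `[< exists g, z' = diag_act z g >].

Lemma diag_act1 z : diag_act z 1%g = z.
Proof. by case: z => x y; rewrite /diag_act /= invg1 ract1 lact1. Qed.

Lemma diag_actM z g h : diag_act z (g * h)%g = diag_act (diag_act z g) h.
Proof. by rewrite /diag_act /= invgM ractM lactM. Qed.

Lemma Gorbit_rel_refl : reflexive Gorbit_rel.
Proof. by move=> z; apply/asboolP; exists 1%g; rewrite diag_act1. Qed.

Lemma Gorbit_rel_sym : symmetric Gorbit_rel.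
Proof.
move=> z z'; apply/asboolP/asboolP => -[g ->]; exists g^-1%g;
  by rewrite -diag_actM mulgV diag_act1.
Qed.

Lemma Gorbit_rel_trans : transitive Gorbit_rel.
Proof.
move=> z' z z'' /asboolP[g ->] /asboolP[h ->]; apply/asboolP.
by exists (g * h)%g; rewrite diag_actM.
Qed.

Definition Gorbit_equiv : equiv_rel (X * F)%type :=
  EquivRel Gorbit_rel Gorbit_rel_refl Gorbit_rel_sym Gorbit_rel_trans.

Definition orbit_space : topologicalType :=
  quotient_topology {eq_quot Gorbit_equiv}.

Definition Gorbit (z : X * F) : orbit_space := \pi_{eq_quot Gorbit_equiv} z.

Lemma GorbitP z z' : Gorbit z = Gorbit z' <-> exists g, z' = diag_act z g.
Proof.
by split=> [/eqmodP/asboolP//|zz']; apply/eqmodP/asboolP.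
Qed.

Lemma Gorbit_surj (e : orbit_space) : exists z, Gorbit z = e.
Proof. by exists (repr (e : {eq_quot Gorbit_equiv})); exact: reprK. Qed.

Definition assoc_proj (e : orbit_space) : B :=
  pbproj P (repr (e : {eq_quot Gorbit_equiv})).1.

Lemma pbproj_act x g : pbproj P (pbact P x g) = pbproj P x.
Proof.
have [i _ Ui] : (\bigcup_i pbcover P i) (pbproj P x) by rewrite pbcoverT.
have [t [_ /(_ x Ui)[[+ _] +] _ _]] := pbtriv_diffeo P i.
case: (t x) => b h /= Ub <-.
by rewrite -pbtriv_act// !pbtriv_proj.
Qed.

Lemma assoc_projE x y : assoc_proj (Gorbit (x, y)) = pbproj P x.
Proof.
have [z zE] : exists z, repr (Gorbit (x, y) : {eq_quot Gorbit_equiv}) = z.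
  by eexists.
have : Gorbit (x, y) = Gorbit z by rewrite -zE /Gorbit reprK.
by rewrite /assoc_proj zE => /GorbitP[g ->]; exact: pbproj_act.
Qed.

(* The smooth structure on the orbit space that makes the quotient map a
   submersion. *)
Record assocBundle := AssocBundle {
  abstruct : smoothStructure R orbit_space ;
  ab_manifold := Manifold abstruct ;
  ab_submersion : @submersion R (prod_manifold X F) ab_manifold Gorbit }.

Definition cross_section (s : B -> orbit_space) : Prop :=
  forall b, assoc_proj (s b) = b.

Definition equivariant (phi : X -> F) : Prop :=
  forall x g, phi (pbact P x g) = a g^-1%g (phi x).

End associated_bundle.

(* Main.v *)
(* Both assignments are pointwise forced: p is surjective, and as G acts freely
   on X, the orbit (x, y) G determines y once x is given. What remains is
   smoothness, which is local. Over a trivializing open set with local section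
   sigma, s_phi is the composite of (sigma, phi o sigma) with the quotient map.
   Conversely, the quotient map is a submersion, so it has smooth local sections
   gamma (by the inverse function theorem). Writing gamma (s (p x)) as
   (u x, y x), the points x and u x lie in the same fiber, so u x = x g with
   g = tau x ^-1 * tau (u x), where tau is the G-coordinate of a local
   trivialization, and phi_s x = g . y x is a composite of smooth maps. *)
From HB Require Import structures.
Require Import Defs.
From mathcomp Require Import all_boot all_order all_algebra.
From mathcomp Require Import all_classical all_reals all_analysis.
From mathcomp Require Import ring lra.

Set Implicit Arguments.
Unset Strict Implicit.
Unset Printing Implicit Defensive.

Import Order.TTheory GRing.Theory Num.Theory.
Import numFieldNormedType.Exports.
Local Open Scope classical_set_scope.
Local Open Scope ring_scope.

(** * Maps of class C^k between Euclidean spaces *)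

Section real_valued_Ck.
Context {R : realType}.

Lemma diff_bound (V W : normedModType R) (f : V -> W) x e :
  differentiable f x -> 0 < e ->
  \forall h \near 0, `|f (h + x) - (f x + 'd f x h)| <= e * `|h|.
Proof.
move=> df e0; have [_ /eqaddoP/(_ e e0)] := (diff_locallyP x f).1 df.
exact: filterS.
Qed.

(** The epsilon form of differentiability, for maps whose differential is guessed first, such as a
    local inverse. *)
Lemma diff_of_bound (V W : normedModType R) (f : V -> W) (L : {linear V -> W})
    x :
  continuous L ->
  (forall e, 0 < e ->
    \forall h \near 0, `|f (h + x) - (f x + L h)| <= e * `|h|) ->
  differentiable f x /\ 'd f x = L :> (V -> W).
Proof.
move=> cL fL; have fE : f \o shift x = cst (f x) + L +o_ 0 id.
  by apply/eqaddoP => e /fL; exact: filterS.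
have df : 'd f x = L :> (V -> W) by exact: diff_unique.
by split=> //; apply/diff_locallyP; rewrite df.
Qed.

(** Stated over normed modules so that it covers [R]-valued functions as well as row-valued ones. *)
Lemma diff_near_eq (V W : normedModType R) (f g : V -> W) x :
  (\near x, f x = g x) -> differentiable f x ->
  differentiable g x /\ 'd g x = 'd f x :> (V -> W).
Proof.
move=> fg df; have fgx : f x = g x by exact: nbhs_singleton fg.
apply: diff_of_bound => [|e e0]; first exact: diff_continuous.
have fg0 : \forall y \near (0 : V), f (y + x) = g (y + x).
  by rewrite (near_shift x); apply: filterS fg => y; rewrite /= sub0r subrK.
by apply: filterS2 fg0 (diff_bound df e0) => y <-; rewrite fgx.
Qed.

(* Working with real-valued coordinates makes products available, hence
   composition, determinants and inverse matrices. *)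
Fixpoint CkR (k : nat) n (U : set 'rV[R]_n) (f : 'rV[R]_n -> R) : Prop :=
  match k with
  | 0 => forall x, U x -> {for x, continuous f}
  | k'.+1 => (forall x, U x -> differentiable f x) /\
             forall v, CkR k' U (fun x => 'd f x v)
  end.

Section fixed_domain.
Context {n : nat} {U : set 'rV[R]_n} (oU : open U).
Implicit Types f g : 'rV[R]_n -> R.

Lemma CkR_ext k f g : (forall x, U x -> f x = g x) -> CkR k U f -> CkR k U g.
Proof.
elim: k f g => [|k IHk] f g fg /=.
  move=> cf x Ux; change (g @ x --> g x); rewrite -fg//.
  apply: cvg_trans (cf x Ux).
  apply: (@near_eq_cvg _ _ (nbhs x) (nbhs_filter x)).
  by apply: filterS (open_nbhs_nbhs (conj oU Ux)) => y Uy; exact: fg.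
have fgx x : U x -> \near x, f x = g x.
  by move=> Ux; apply: filterS (open_nbhs_nbhs (conj oU Ux)) => y Uy; exact: fg.
move=> [df cf]; split=> [x Ux|v].
  by have [] := diff_near_eq (fgx x Ux) (df x Ux).
apply: IHk (cf v) => x Ux.
have [_ E] := diff_near_eq (fgx x Ux) (df x Ux).
exact: esym (congr1 (fun L => L v) E).
Qed.

Lemma CkRW k f : CkR k.+1 U f -> CkR k U f.
Proof.
elim: k f => [|k IHk] f [df cf].
  by move=> x Ux; apply: differentiable_continuous; exact: df.
by split=> // v; exact/IHk/cf.
Qed.

Lemma CkR_cst k c : CkR k U (cst c).
Proof.
elim: k c => [|k IHk] c /=; first by move=> x _; exact: cst_continuous.
split=> [x _|v]; first exact: differentiable_cst.
apply: CkR_ext (IHk 0) => x _.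
have -> : 'd (cst c) x = 0 :> ('rV[R]_n -> R) by exact: diff_cst.
by [].
Qed.

Lemma CkRD k f g : CkR k U f -> CkR k U g -> CkR k U (fun x => f x + g x).
Proof.
elim: k f g => [|k IHk] f g /= cf cg.
  by move=> x Ux; apply: continuousD; [exact: cf|exact: cg].
have [df {}cf] := cf; have [dg {}cg] := cg; split=> [x Ux|v].
  by apply: differentiableD; [exact: df|exact: dg].
apply: CkR_ext (IHk _ _ (cf v) (cg v)) => // x Ux.
exact: esym (congr1 (fun L => L v) (diffD (df x Ux) (dg x Ux))).
Qed.

(** Leibniz rule: each term of the derivative keeps one factor undifferentiated, and [CkRW] lowers
    its class before the induction hypothesis applies. *)
Lemma CkRM k f g : CkR k U f -> CkR k U g -> CkR k U (fun x => f x * g x).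
Proof.
elim: k f g => [|k IHk] f g cf cg.
  by move=> x Ux; apply: continuousM; [exact: cf|exact: cg].
have [df ddf] := cf; have [dg ddg] := cg; split=> [x Ux|v].
  by apply: differentiableM; [exact: df|exact: dg].
have := CkRD (IHk _ _ (CkRW cf) (ddg v)) (IHk _ _ (CkRW cg) (ddf v)).
apply: CkR_ext => x Ux.
exact: esym (congr1 (fun L => L v) (diffM (df x Ux) (dg x Ux))).
Qed.

Lemma CkR_sum k (I : Type) (r : seq I) (p : pred I) (F : I -> 'rV[R]_n -> R) :
  (forall i, p i -> CkR k U (F i)) ->
  CkR k U (fun x => \sum_(i <- r | p i) F i x).
Proof.
move=> cF; elim: r => [|i r IHr].
  by apply: CkR_ext (CkR_cst k 0) => x _; rewrite big_nil.
apply: (@CkR_ext _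
  (fun x => (if p i then F i x else 0) + \sum_(i <- r | p i) F i x)).
  by move=> x _; rewrite big_cons; case: ifP; rewrite ?add0r.
by apply: (CkRD _ IHr); case pi: (p i); [exact: cF|exact: CkR_cst].
Qed.

Lemma CkR_prod k (I : Type) (r : seq I) (p : pred I) (F : I -> 'rV[R]_n -> R) :
  (forall i, p i -> CkR k U (F i)) ->
  CkR k U (fun x => \prod_(i <- r | p i) F i x).
Proof.
move=> cF; elim: r => [|i r IHr].
  by apply: CkR_ext (CkR_cst k 1) => x _; rewrite big_nil.
apply: (@CkR_ext _
  (fun x => (if p i then F i x else 1) * \prod_(i <- r | p i) F i x)).
  by move=> x _; rewrite big_cons; case: ifP; rewrite ?mul1r.
by apply: (CkRM _ IHr); case pi: (p i); [exact: cF|exact: CkR_cst].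
Qed.

(** The derivative of [1/f] is [- f^-2 * df], whose factors are of class C^k by induction. *)
Lemma CkRV k f : (forall x, U x -> f x != 0) -> CkR k U f ->
  CkR k U (fun x => (f x)^-1).
Proof.
move=> f0; elim: k => [|k IHk] cf.
  by move=> x Ux; apply: continuousV; [exact: f0|exact: cf].
have [df ddf] := cf; split=> [x Ux|v].
  by apply: differentiableV; [exact: df|exact: f0].
have cV := IHk (CkRW cf).
have := CkRM (CkR_cst k (-1)) (CkRM (CkRM cV cV) (ddf v)).
apply: CkR_ext => x Ux; apply: esym.
apply: etrans (congr1 (fun L => L v) (diffV (df x Ux) (f0 x Ux))) _.
rewrite /cst mulN1r -expr2 exprVn -mulNr.
reflexivity.
Qed.

End fixed_domain.

(** [Ck] constrains the total map point by point, through ['d], so the conditions at [x] on [V]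
    already serve on [U]. *)
Lemma Ck_local k n m (U : set 'rV[R]_n) (f : 'rV[R]_n -> 'rV[R]_m) :
  (forall x, U x -> exists2 V, V x & Ck k V f) -> Ck k U f.
Proof.
elim: k f => [|k IHk] f Uf /=.
  by move=> x /Uf[V Vx cf]; exact: (cf x Vx).
split=> [x /Uf[V Vx [df _]]|v]; first exact: df.
by apply: IHk => x /Uf[V Vx [_ cf]]; exists V => //; exact: cf.
Qed.

(** * Vector-valued maps through their coordinates *)

Section coordinates.
Context {n m : nat}.
Implicit Type f : 'rV[R]_n -> 'rV[R]_m.

Lemma diff_coord f x j : differentiable f x ->
  differentiable (fun y => f y 0 j) x /\
  forall v, 'd (fun y => f y 0 j) x v = 'd f x v 0 j.
Proof.
have lin : linear (fun w : 'rV[R]_m => w 0 j) by move=> a u v; rewrite !mxE.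
pose L : {linear 'rV[R]_m -> R} :=
  HB.pack (fun w : 'rV[R]_m => w 0 j) (GRing.isLinear.Build _ _ _ _ _ lin).
have cL : continuous L by exact: coord_continuous.
have dL y : differentiable L y by exact: linear_differentiable.
move=> df; have -> : (fun y => f y 0 j) = L \o f by [].
split=> [|v]; first exact: differentiable_comp.
apply: etrans (congr1 (fun h => h v) (diff_comp df (dL _))) _.
exact: (congr1 (fun h => h ('d f x v)) (diff_lin _ cL)).
Qed.

Lemma differentiable_rowP f x :
  (forall j, differentiable (fun y => f y 0 j) x) -> differentiable f x.
Proof.
move=> df.
have -> : f = \sum_(j < m) (fun y => f y 0 j *: (delta_mx 0 j : 'rV[R]_m)).
  by apply/funext => y; rewrite fct_sumE {1}[f y]row_sum_delta.
by apply: differentiable_sum => j; exact: differentiableZl.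
Qed.

Lemma CkP k (U : set 'rV[R]_n) f : open U ->
  Ck k U f <-> forall j, CkR k U (fun x => f x 0 j).
Proof.
move=> oU; elim: k f => [|k IHk] f /=.
  split=> [cf j x Ux|cf x Ux].
    apply: (@continuous_comp _ _ _ f (fun w => w 0 j)); first exact: cf.
    exact: coord_continuous.
  move=> A /nbhs_ballP[e /= e0 eA].
  (* A ball of row vectors is a product of balls, so finitely many coordinate neighbourhoods are
     intersected. *)
  have fA : \forall y \near x, forall j, ball (f x 0 j) e (f y 0 j).
    apply: (@filter_forall _ _
      (fun j y => ball (f x 0 j) e (f y 0 j)) (nbhs x)) => j.
    by apply: (cf j x Ux); exact: nbhsx_ballx.
  apply: filterS fA => y fxy; apply: eA; split=> // i j.
  by rewrite ord1; exact: fxy.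
split=> [[df cf] j|cf].
  split=> [x /df/(diff_coord j)[]//|v].
  apply: (CkR_ext oU) ((IHk _).1 (cf v) j) => x /df/(diff_coord j)[_ E].
  by rewrite E.
have df x : U x -> differentiable f x.
  by move=> Ux; apply: differentiable_rowP => j; have [df _] := cf j; exact: df.
split=> // v; apply/IHk => j; have [_ cfj] := cf j.
by apply: (CkR_ext oU) (cfj v) => x /df/(diff_coord j)[_ E].
Qed.

End coordinates.

Lemma CkR_coord k n (U : set 'rV[R]_n) j :
  open U -> CkR k U (fun x : 'rV[R]_n => x 0 j).
Proof.
move=> oU; case: k => [|k] /=; first by move=> x _; exact: coord_continuous.
have did (x : 'rV[R]_n) : differentiable id x.
  exact: (@ex_diff _ _ _ _ _ _ _ (is_diff_id x)).
split=> [x _|v]; first by have [] := diff_coord j (did x).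
apply: (CkR_ext oU) (CkR_cst oU k (v 0 j)) => x _.
have [_ ->] := diff_coord j (did x).
have -> : 'd id x = id :> ('rV[R]_n -> 'rV[R]_n).
  exact: (@diff_val _ _ _ _ _ _ _ (is_diff_id x)).
by [].
Qed.

Lemma linear_row_sum n (V : lmodType R) (L : {linear 'rV[R]_n -> V}) v :
  L v = \sum_j v 0 j *: L (delta_mx 0 j).
Proof.
by rewrite {1}[v]row_sum_delta linear_sum; apply: eq_bigr => j _;
  rewrite linearZ.
Qed.

(** * Chain rule, determinants and inverse matrices *)

Section composition.
Context {n m : nat} {U : set 'rV[R]_n} {V : set 'rV[R]_m}.
Variables (oU : open U) (oV : open V).

Lemma CkW k (g : 'rV[R]_n -> 'rV[R]_m) : Ck k.+1 U g -> Ck k U g.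
Proof. by move=> /(CkP _ _ oU) cg; apply/(CkP _ _ oU) => j; exact: CkRW. Qed.

Lemma CkR_comp k (f : 'rV[R]_m -> R) (g : 'rV[R]_n -> 'rV[R]_m) :
  (forall x, U x -> V (g x)) -> CkR k V f -> Ck k U g -> CkR k U (f \o g).
Proof.
move=> gV; elim: k f => [|k IHk] f cf cg.
  by move=> x Ux; apply: continuous_comp; [exact: cg|exact/cf/gV].
have [df ddf] := cf; have [dg ddg] := cg; split=> [x Ux|v].
  by apply: differentiable_comp; [exact: dg|exact/df/gV].
(* The chain rule is expanded in the standard basis: each term is a product of a coordinate of
   ['d g x v] and a partial derivative of [f] composed with [g]. The induction hypothesis handles
   the latter. *)
apply: (@CkR_ext _ _ oU k
  (fun x => \sum_j ('d g x v) 0 j * 'd f (g x) (delta_mx 0 j))).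
  move=> x Ux; rewrite (diff_comp (dg x Ux) (df _ (gV _ Ux))) /=.
  by rewrite [RHS]linear_row_sum.
apply: (CkR_sum oU) => j _; apply: (CkRM oU).
  by have /(CkP _ _ oU) := ddg v; exact.
exact: (IHk (fun y => 'd f y (delta_mx 0 j)) (ddf _) (CkW cg)).
Qed.

Lemma Ck_comp k p (f : 'rV[R]_m -> 'rV[R]_p) (g : 'rV[R]_n -> 'rV[R]_m) :
  (forall x, U x -> V (g x)) -> Ck k V f -> Ck k U g -> Ck k U (f \o g).
Proof.
move=> gV /(CkP _ _ oV) cf cg; apply/(CkP _ _ oU) => j.
exact: CkR_comp (cf j) cg.
Qed.

End composition.

Lemma CkR_det k n p (U : set 'rV[R]_n) (M : 'rV[R]_n -> 'M[R]_p) : open U ->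
  (forall i j, CkR k U (fun x => M x i j)) -> CkR k U (fun x => \det (M x)).
Proof.
move=> oU cM; apply: (CkR_sum oU) => s _; apply: (CkRM oU).
  exact: CkR_cst.
by apply: (CkR_prod oU) => i _; exact: cM.
Qed.

(** Cramer's rule: the [(i, j)] entry of the inverse is the [(j, i)] cofactor divided by the
    determinant. *)
Lemma CkR_invmx k n p (U : set 'rV[R]_n) (M : 'rV[R]_n -> 'M[R]_p) : open U ->
  (forall x, U x -> M x \in unitmx) ->
  (forall i j, CkR k U (fun x => M x i j)) ->
  forall i j, CkR k U (fun x => invmx (M x) i j).
Proof.
move=> oU uM cM i j.
apply: (@CkR_ext _ _ oU k
  (fun x => (\det (M x))^-1 *
    ((-1) ^+ (j + i) * \det (row' j (col' i (M x)))))).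
  by move=> x Ux; rewrite /invmx uM// !mxE.
have cdet := CkR_det oU cM.
apply: (CkRM oU).
  by apply: (CkRV oU) cdet => x /uM; rewrite unitmxE unitfE.
apply: (CkRM oU); first exact: CkR_cst.
apply: (CkR_det oU) => i' j'.
by apply: (CkR_ext oU) (cM (lift j i') (lift i j')) => x _; rewrite !mxE.
Qed.

Lemma Ck_affine k n m (U : set 'rV[R]_n) (c : 'rV[R]_m) (A : 'M[R]_(n, m)) :
  open U -> Ck k U (fun x => c + x *m A).
Proof.
move=> oU; apply/(CkP _ _ oU) => j.
apply: (@CkR_ext _ _ oU k (fun x => c 0 j + \sum_i x 0 i * A i j)).
  by move=> x _; rewrite !mxE.
apply: (CkRD oU); first exact: CkR_cst.
apply: (CkR_sum oU) => i _; apply: (CkRM oU); first exact: CkR_coord.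
exact: CkR_cst.
Qed.

Lemma continuous_mulmxr n m (A : 'M[R]_(n, m)) :
  continuous (fun x : 'rV[R]_n => x *m A).
Proof.
have oT : open ([set: 'rV[R]_n]) by exact: openT.
move=> x.
have : Ck 0 setT (fun x => 0 + x *m A) by exact: Ck_affine.
have -> : (fun x => 0 + x *m A) = mulmx^~ A :> ('rV[R]_n -> 'rV[R]_m).
  by apply/funext => y; rewrite add0r.
by move/(_ x I).
Qed.

End real_valued_Ck.

(** * The inverse function theorem *)

Section inverse_function.
Context {R : realType}.

Lemma normr_coord n (v : 'rV[R]_n) j : `|v 0 j| <= `|v|.
Proof.
rewrite [leRHS]/Num.Def.normr /= mx_normrE.
by apply/bigmax_geP; right => /=; exists (0, j).
Qed.

Lemma normr_row_le n (v : 'rV[R]_n) c :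
  0 <= c -> (forall j, `|v 0 j| <= c) -> `|v| <= c.
Proof.
move=> c0 vc; rewrite [leLHS]/Num.Def.normr /= mx_normrE.
by apply: bigmax_le => // -[i j] _ /=; rewrite ord1.
Qed.

(** The one-variable mean value theorem along the segment [t |-> x + t *: h]. *)
Lemma mean_value_row n (f : 'rV[R]_n -> R) x h :
  (forall t, 0 <= t <= 1 -> differentiable f (x + t *: h)) ->
  exists2 t, 0 <= t <= 1 & f (x + h) - f x = 'd f (x + t *: h) h.
Proof.
move=> df; pose l (t : R) := x + t *: h.
have dlh (t : R) : differentiable (fun s : R => s *: h) t.
  exact: (@ex_diff _ _ _ _ _ _ _ (is_diff_scalel t h)).
have dl (t : R) : differentiable l t.
  exact: (differentiableD (differentiable_cst x t) (dlh t)).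
have dlE (t : R) : 'd l t 1 = h.
  have lE : 'd l t = 'd (cst x) t \+ 'd (fun s : R => s *: h) t :> (R -> _).
    exact: (diffD (differentiable_cst x t) (dlh t)).
  have xE : 'd (cst x) t = 0 :> (R -> 'rV[R]_n) by exact: diff_cst.
  have hE : 'd (fun s : R => s *: h) t = *:%R^~ h :> (R -> _).
    exact: (@diff_val _ _ _ _ _ _ _ (is_diff_scalel t h)).
  apply: etrans (congr1 (fun L => L 1) lE) _.
  have xhE := congr2 (fun a b : R -> 'rV[R]_n => a 1 + b 1) xE hE.
  by apply: etrans xhE _; rewrite scale1r; exact: add0r.
have dfl (t : R) : 0 <= t <= 1 -> is_derive t 1 (f \o l) ('d f (l t) h).
  move=> /df dft; have dfl := differentiable_comp (dl t) dft.
  apply: DeriveDef; first exact: diff_derivable.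
  by rewrite deriveE// (diff_comp (dl t) dft)/= dlE.
have [||t] := @MVT_segment R (f \o l) (fun t => 'd f (l t) h) 0 1 ler01.
- move=> t; rewrite in_itv /= => /andP[/ltW t0 /ltW t1].
  by apply: dfl; rewrite t0.
- apply: derivable_within_continuous => t; rewrite in_itv /= => /dfl dt.
  exact: ex_derive.
rewrite in_itv /= /l scale1r scale0r addr0 subr0 mulr1 => t01 E.
by exists t.
Qed.

Lemma ball_segment n (x y : 'rV[R]_n) (c : 'rV[R]_n) r t :
  ball c r x -> ball c r y -> 0 <= t <= 1 -> ball c r (x + t *: (y - x)).
Proof.
rewrite -ball_normE /= => xc yc /andP[t0 t1].
have -> : c - (x + t *: (y - x)) = (1 - t) *: (c - x) + t *: (c - y).
  by apply/rowP => j; rewrite !mxE; ring.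
apply: le_lt_trans (ler_normD _ _) _.
rewrite !normrZ !ger0_norm ?subr_ge0//.
have : Num.max `|c - x| `|c - y| < r by rewrite gt_max xc.
apply: le_lt_trans; set m := Num.max _ _.
have xm : `|c - x| <= m by rewrite le_max lexx.
have ym : `|c - y| <= m by rewrite le_max lexx orbT.
by nra.
Qed.

Lemma near0_lt n m (D : 'rV[R]_n -> 'rV[R]_m) x e :
  {for x, continuous D} -> D x = 0 -> 0 < e -> \near x, `|D x| < e.
Proof.
move=> /cvgrPdist_lt cD D0 /cD; apply: filterS => y.
by rewrite D0 sub0r normrN.
Qed.

(** * Contraction estimates where the perturbation has zero differential *)

Section near_identity.
Context {n : nat} {W : set 'rV[R]_n} {x0 : 'rV[R]_n}.
Context {phi : 'rV[R]_n -> 'rV[R]_n}.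
Hypotheses (oW : open W) (Wx0 : W x0) (cphi : Cinfty W phi)
  (dphi0 : forall v, 'd phi x0 v = 0).

Lemma diff_small : exists2 r, 0 < r & ball x0 r `<=` W /\
  forall x h, ball x0 r x -> `|'d phi x h| <= 2^-1 * `|h|.
Proof.
(* Expanding [h] in the basis gives a sum of [n] terms, each at most [|h| * e], hence the factor
   1/2; [n.+1] keeps [e] well defined for [n = 0]. *)
pose e : R := (2 * n.+1%:R)^-1.
have e0 : 0 < e by rewrite invr_gt0 mulr_gt0.
have near_i : \forall x \near x0, forall i, `|'d phi x (delta_mx 0 i)| < e.
  apply: (@filter_forall _ _ (fun i x => `|'d phi x (delta_mx 0 i)| < e)
    (nbhs x0)) => i.
  exact: (near0_lt ((cphi 1).2 (delta_mx 0 i) x0 Wx0)).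
have : \forall x \near x0, W x /\ forall i, `|'d phi x (delta_mx 0 i)| < e.
  by apply: filterI near_i; exact: open_nbhs_nbhs.
move=> /nbhs_ballP[r /= r0 rP]; exists r => //.
split=> [x /rP[]//|x h /rP[_ xe]].
rewrite linear_row_sum.
apply: le_trans (ler_norm_sum _ _ _) _.
apply: (@le_trans _ _ (\sum_(j < n) `|h| * e)).
  by apply: ler_sum => j _; rewrite normrZ ler_pM// ?normr_coord// ltW.
rewrite sumr_const card_ord -mulrnAr mulrC ler_wpM2r// -mulr_natr /e invfM.
by rewrite -mulrA ler_piMr ?invr_ge0// ler_pdivrMl// mulr1 ler_nat.
Qed.

(** The intermediate point of the mean value theorem depends on the coordinate, so each coordinate
    is bounded separately; this suffices for the sup norm. *)
Lemma contraction_of_diff r : ball x0 r `<=` W ->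
  (forall x h, ball x0 r x -> `|'d phi x h| <= 2^-1 * `|h|) ->
  forall x y, ball x0 r x -> ball x0 r y ->
    `|phi y - phi x| <= 2^-1 * `|y - x|.
Proof.
move=> rW small x y rx ry; apply: normr_row_le => [|j].
  by rewrite mulr_ge0// invr_ge0.
have dphi t : 0 <= t <= 1 -> differentiable phi (x + t *: (y - x)).
  by move=> t01; apply: (cphi 1).1; apply/rW/ball_segment.
have [|t t01] := @mean_value_row _ (fun z => phi z 0 j) x (y - x).
  by move=> t /dphi/(diff_coord j)[].
have [_ ->] := diff_coord j (dphi t t01).
rewrite subrKC !mxE => ->.
by apply: le_trans (normr_coord _ _) _; apply/small/ball_segment.
Qed.

End near_identity.

(** A solution of [x - phi x = y] is a fixed point of [T x = phi x + y], and Banach's theorem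
    applies on the closed ball of radius [r / 2], which lies inside the open ball of radius [r]. *)
Lemma id_sub_contraction_surj n (phi : 'rV[R]_n -> 'rV[R]_n) x0 r y : 0 < r ->
  (forall x y, ball x0 r x -> ball x0 r y ->
    `|phi y - phi x| <= 2^-1 * `|y - x|) ->
  ball (x0 - phi x0) (4^-1 * r) y -> exists2 x, ball x0 r x & x - phi x = y.
Proof.
move=> r0 phi_lip yr.
have {}yr : `|x0 - phi x0 - y| < 4^-1 * r by move: yr; rewrite -ball_normE.
pose U : set 'rV[R]_n := closed_ball_ Num.Def.normr x0 (2^-1 * r).
have Ur : U `<=` ball x0 r.
  move=> x; rewrite /U /closed_ball_ -ball_normE /= => /le_lt_trans; apply.
  by rewrite gtr_pMl// invf_lt1// ltr1n.
have rx0 : ball x0 r x0 by exact: ballxx.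
pose T x := phi x + y.
have TU : set_fun U U T.
  move=> x Ux; have := phi_lip _ _ (Ur _ Ux) rx0.
  move: Ux; rewrite /U /closed_ball_ /= => Ux px.
  (* The first summand is at most half of [r / 2], the second is below [r / 4]: together they stay
     within [r / 2]. *)
  have -> : x0 - T x = (phi x0 - phi x) + (x0 - phi x0 - y).
    by apply/rowP => j; rewrite !mxE; ring.
  by apply: le_trans (ler_normD _ _) _; lra.
pose fT : {fun U >-> U} := HB.pack T (isFun.Build _ _ U U T TU).
have q0 : (0 : R) <= 2^-1 by rewrite invr_ge0.
(* [X] is the space of row vectors with its completeness attached, as the fixed point theorem
   expects. *)
pose X : completeNormedModType R :=
  HB.pack 'rV[R]_n (Uniform_isComplete.Build 'rV[R]_n (@mx_complete R 1 n)).
have fT_ctr : @is_contraction R X X U U fT.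
  exists (NngNum q0); split; first by rewrite /= invf_lt1// ltr1n.
  move=> [a b] [/= Ua Ub].
  change (`|phi a + y - (phi b + y)| <= 2^-1 * `|a - b|).
  rewrite opprD addrACA subrr addr0.
  exact: phi_lip (Ur _ Ub) (Ur _ Ua).
have U_closed : @closed X U by exact: closed_closed_ball_.
have U_neq0 : U !=set0.
  by exists x0; rewrite /U /closed_ball_ /= subrr normr0 mulr_ge0// ltW.
have [x Ux xE] := banach_fixed_point fT_ctr U_closed U_neq0.
have {}xE : x = phi x + y by exact: xE.
exists x; first exact: (Ur x Ux).
by rewrite {1}xE addrC addKr.
Qed.

(** The Jacobian matrix of [id - phi], acting on row vectors from the right. *)
Definition id_sub_jac n (phi : 'rV[R]_n -> 'rV[R]_n) x : 'M[R]_n :=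
  1%:M - lin1_mx ('d phi x).

(** A kernel vector satisfies [v = 'd phi x v], so [|v| <= |v| / 2] and [v = 0]. *)
Lemma id_sub_jac_unit n (phi : 'rV[R]_n -> 'rV[R]_n) x :
  (forall h, `|'d phi x h| <= 2^-1 * `|h|) -> id_sub_jac phi x \in unitmx.
Proof.
move=> small; rewrite -row_free_unit; apply: inj_row_free => v.
rewrite mulmxBr mulmx1 mul_rV_lin1 => /eqP; rewrite subr_eq0 => /eqP vE.
have := small v; rewrite -vE => v2.
by apply/eqP; rewrite -normr_le0; have := normr_ge0 v; lra.
Qed.

(** The remainder of [g] at [y] is the remainder of [phi] at [g y], for the increment
    [dl = g (h + y) - g y], multiplied by the inverse Jacobian. As [|dl| <= 2 |h|], an o(dl) is an
    o(h). *)
Lemma inverse_diff n (phi g : 'rV[R]_n -> 'rV[R]_n) (V : set 'rV[R]_n) y :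
  open V -> V y -> differentiable phi (g y) ->
  (forall h, `|'d phi (g y) h| <= 2^-1 * `|h|) ->
  (forall z, V z -> g z - phi (g z) = z) ->
  (forall z z', V z -> V z' -> `|g z - g z'| <= 2 * `|z - z'|) ->
  differentiable g y /\ forall v, 'd g y v = v *m invmx (id_sub_jac phi (g y)).
Proof.
move=> oV Vy dphi small gK glip; set M := id_sub_jac _ _; set x := g y.
have uM : M \in unitmx by exact: id_sub_jac_unit.
pose L : {linear 'rV[R]_n -> 'rV[R]_n} := mulmxr (invmx M).
have cL : continuous L by exact: continuous_mulmxr.
have [C C0 CL] := linear_lipschitz cL.
have [//|e e0|dg dgE] := @diff_of_bound R _ _ g L y; last first.
  by split=> // v; exact: (congr1 (fun F : 'rV[R]_n -> 'rV[R]_n => F v) dgE).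
(* Chosen to absorb the norm bound [C] of the inverse Jacobian and the Lipschitz constant 2 of
   [g]. *)
pose e' := e / (2 * C).
have e'0 : 0 < e' by rewrite divr_gt0// mulr_gt0.
have /nbhs_ballP[d /= d0 phiE] := diff_bound dphi e'0.
have Vh : \forall h \near (0 : 'rV[R]_n), V (h + y).
  rewrite (near_shift y); apply: filterS (open_nbhs_nbhs (conj oV Vy)) => z.
  by rewrite /= sub0r subrK.
(* Radius [d / 2], so that [|dl| <= 2 |h| < d]. *)
have hd : \forall h \near (0 : 'rV[R]_n), ball 0 (2^-1 * d) h.
  by apply: nbhsx_ballx; rewrite mulr_gt0// invr_gt0.
apply: filterS2 Vh hd => h Vh; rewrite -ball_normE /= sub0r normrN => hd.
pose dl := g (h + y) - x.
have dlh : `|dl| <= 2 * `|h| by have := glip _ _ Vh Vy; rewrite addrK.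
have /phiE /= : ball 0 d dl.
  by rewrite -ball_normE /= sub0r normrN; lra.
rewrite subrK; set eps := phi _ - _ => epsP.
have -> : g (h + y) - (g y + h *m invmx M) = eps *m invmx M.
  rewrite opprD addrA -[_ - g y]/dl.
  have -> : eps = dl *m M - h.
    rewrite /eps mulmxBr mulmx1 mul_rV_lin1.
    have hE : h = dl - (phi (g (h + y)) - phi x).
      apply: etrans (esym (addrK y h)) _.
      apply: etrans (congr2 (fun a b => a - b)
        (esym (gK _ Vh)) (esym (gK _ Vy))) _.
      by rewrite /dl /x; apply/rowP => j; rewrite !mxE; ring.
    by rewrite {2}hE /x; apply/rowP => j; rewrite !mxE; ring.
  by rewrite mulmxBl -mulmxA mulmxV// mulmx1.
apply: le_trans (CL _) _.
have -> : e * `|h| = C * (e' * (2 * `|h|)).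
  by rewrite /e'; field; rewrite gt_eqF.
by rewrite ler_pM2l//; apply: le_trans epsP _; rewrite ler_pM2l.
Qed.

(** Bootstrapping: ['d g] is given by the inverse of the Jacobian of [id - phi] at [g y], so if [g]
    is C^k then ['d g] is C^k and [g] is C^(k+1). *)
Lemma inverse_Cinfty n (phi g : 'rV[R]_n -> 'rV[R]_n) (V W : set 'rV[R]_n) :
  open V -> open W -> Cinfty W phi ->
  (forall x h, W x -> `|'d phi x h| <= 2^-1 * `|h|) ->
  (forall z, V z -> W (g z)) ->
  (forall z, V z -> g z - phi (g z) = z) ->
  (forall z z', V z -> V z' -> `|g z - g z'| <= 2 * `|z - z'|) ->
  Cinfty V g.
Proof.
move=> oV oW cphi small gW gK glip.
have gdiff y : V y -> differentiable g y /\
    forall v, 'd g y v = v *m invmx (id_sub_jac phi (g y)).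
  move=> Vy; have Wgy := gW y Vy; apply: (inverse_diff oV Vy) => //.
    exact: (cphi 1).1.
  by move=> h; exact: small.
elim=> [|k IHk].
  by move=> y /gdiff[dg _]; exact: differentiable_continuous.
split=> [y /gdiff[]//|v]; apply/(CkP _ _ oV) => j.
apply: (@CkR_ext _ _ _ oV k
  (fun y => \sum_i v 0 i * invmx (id_sub_jac phi (g y)) i j)).
  by move=> y /gdiff[_ ->]; rewrite mxE.
apply: (CkR_sum oV) => i _; apply: (CkRM oV); first exact: CkR_cst.
apply: (CkR_invmx oV) => [y Vy|i' j'].
  by apply: id_sub_jac_unit => h; apply/small/gW.
apply: (@CkR_ext _ _ _ oV k (fun y => (1%:M : 'M[R]_n) i' j' +
  -1 * 'd phi (g y) (delta_mx 0 i') 0 j')).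
  by move=> y _; rewrite !mxE mulN1r.
apply: (CkRD oV); first exact: CkR_cst.
apply: (CkRM oV); first exact: CkR_cst.
have /(CkP _ _ oW)/(_ j') cphi' := (cphi k.+1).2 (delta_mx 0 i').
exact: (CkR_comp oV gW cphi' IHk).
Qed.

(* Up to an affine change of coordinates the map to invert is [id - phi] with
   ['d phi x0 = 0], so that [w |-> phi w + y] is a contraction near [x0]. *)
Theorem inverse_function_id_sub n (W : set 'rV[R]_n)
    (phi : 'rV[R]_n -> 'rV[R]_n) x0 :
  open W -> W x0 -> Cinfty W phi -> (forall v, 'd phi x0 v = 0) ->
  exists (V : set 'rV[R]_n) (g : 'rV[R]_n -> 'rV[R]_n),
    [/\ open V, V (x0 - phi x0), Cinfty V g &
        forall y, V y -> W (g y) /\ g y - phi (g y) = y].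
Proof.
move=> oW Wx0 cphi dphi0.
have [r r0 [rW small]] := diff_small oW Wx0 cphi dphi0.
have phi_lip := contraction_of_diff cphi rW small.
pose V := ball (x0 - phi x0) (4^-1 * r).
(* [g] has to be total; off [V] it takes the default value 0. *)
have /choice[g gV] : forall y, exists x, V y -> ball x0 r x /\ x - phi x = y.
  move=> y; have [Vy|nVy] := pselect (V y); last by exists 0 => /nVy.
  have [x rx xE] := id_sub_contraction_surj r0 phi_lip Vy.
  by exists x.
have oV : open V by exact: ball_open.
exists V, g; split=> //.
- by apply: ballxx; rewrite mulr_gt0// invr_gt0.
- apply: (@inverse_Cinfty _ phi _ _ (ball x0 r)) => //.
  + exact: ball_open.
  + by move=> k; exact: Ck_sub (cphi k).
  + by move=> y /gV[].
  + by move=> y /gV[].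
  (* On [V], [g = id + phi \o g], so [|g y - g z| <= |y - z| + |g y - g z| / 2], whence the
     Lipschitz constant 2. *)
  move=> y z Vy Vz; have [rx xE] := gV _ Vy; have [rx' xE'] := gV _ Vz.
  have := phi_lip _ _ rx' rx.
  have : `|g y - g z| <= `|phi (g y) - phi (g z)| + `|y - z|.
    have yzE : y - z = (g y - phi (g y)) - (g z - phi (g z)) by rewrite xE xE'.
    apply: le_trans (ler_normD _ _); rewrite yzE.
    suff <- : g y - g z = phi (g y) - phi (g z) +
        (g y - phi (g y) - (g z - phi (g z))) by [].
    by apply/rowP => j; rewrite !mxE; ring.
  by lra.
- by move=> y /gV[/rW].
Qed.

(* [A] is a right inverse of ['d f u0]; restricted to the slice [u0 + w *m A],
   [f] has identity differential at [w = 0] and can be inverted. *)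
Theorem submersion_local_section n m (U : set 'rV[R]_n)
    (f : 'rV[R]_n -> 'rV[R]_m) u0 :
  open U -> U u0 -> Cinfty U f -> (forall w, exists v, 'd f u0 v = w) ->
  exists (V : set 'rV[R]_m) (g : 'rV[R]_m -> 'rV[R]_n),
    [/\ open V, V (f u0), Cinfty V g & forall y, V y -> U (g y) /\ f (g y) = y].
Proof.
move=> oU Uu0 cf df_surj.
have /choice[v vE] := fun j : 'I_m => df_surj (delta_mx 0 j).
pose A : 'M[R]_(m, n) := \matrix_j v j.
pose i (w : 'rV[R]_m) := u0 + w *m A.
have i0 : i 0 = u0 by rewrite /i mul0mx addr0.
have oT : open [set: 'rV[R]_m] by exact: openT.
have ci k : Ck k setT i by exact: Ck_affine.
have oW : open (i @^-1` U) by apply: open_comp => // w _; exact: (ci 0).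
have [di diE] : differentiable i 0 /\ 'd i 0 = mulmxr A :> (_ -> _).
  apply: (@diff_of_bound R _ _ i (mulmxr A)) => [|e e0].
    exact: continuous_mulmxr.
  apply: filterE => h; rewrite /i addr0 mul0mx addr0 subrr normr0.
  by rewrite mulr_ge0// ltW.
pose phi w := w - f (i w).
have cphi : Cinfty (i @^-1` U) phi.
  move=> k; apply/(CkP _ _ oW) => j.
  apply: (@CkR_ext _ _ _ oW k (fun w => w 0 j + -1 * (f (i w)) 0 j)).
    by move=> w _; rewrite !mxE mulN1r.
  apply: (CkRD oW); first exact: CkR_coord.
  apply: (CkRM oW); first exact: CkR_cst.
  have cfi : Ck k (i @^-1` U) (f \o i).
    by apply: (Ck_comp oW oU) => //; apply: Ck_sub (ci k).
  exact: ((CkP k (f \o i) oW).1 cfi j).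
have dphi0 h : 'd phi 0 h = 0.
  have dfu : differentiable f (i 0) by rewrite i0; exact: (cf 1).1.
  have did : differentiable (fun w : 'rV[R]_m => w) 0.
    exact: (@ex_diff _ _ _ _ _ _ _ (is_diff_id 0)).
  have didE : 'd (fun w : 'rV[R]_m => w) 0 = id :> (_ -> _).
    exact: (@diff_val _ _ _ _ _ _ _ (is_diff_id 0)).
  have dfi := differentiable_comp di dfu.
  apply: etrans (congr1 (fun F => F h) (diffB did dfi)) _.
  (* The rows of [A] are preimages under ['d f u0] of the basis vectors, so
     ['d f u0 (h *m A) = h]. *)
  have fiE : 'd (f \o i) 0 h = h.
    apply: etrans (congr1 (fun F => F h) (diff_comp di dfu)) _.
    apply: etrans (congr1 (fun F : _ -> _ => 'd f (i 0) (F h)) diE) _.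
    rewrite /= i0 mulmx_sum_row linear_sum [RHS]row_sum_delta.
    by apply: eq_bigr => j _; rewrite linearZ /= rowK vE.
  apply: etrans (congr2 (fun a b => a - b) (congr1 (fun F => F h) didE) fiE) _.
  exact: subrr.
have W0 : (i @^-1` U) 0 by rewrite /= i0.
have [V [g [oV V0 cg gV]]] := inverse_function_id_sub oW W0 cphi dphi0.
exists V, (i \o g); split=> //.
- by move: V0; rewrite /phi i0 opprB addrC subrK.
- by move=> k; apply: (Ck_comp oV oT) (cg k).
- by move=> y /gV[Wgy]; rewrite /phi opprB addrC subrK.
Qed.

End inverse_function.

(** * Smooth maps between manifolds *)

Section smooth_manifold_maps.
Context {R : realType}.

Lemma open_setI_preimage (S T : topologicalType) (f : S -> T) (U : set S)
    (V : set T) :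
  open U -> (forall x, U x -> {for x, continuous f}) -> open V ->
  open (U `&` f @^-1` V).
Proof.
move=> oU cf oV; rewrite openE => x [Ux Vfx]; apply: filterI.
  exact: open_nbhs_nbhs.
by apply: (cf x Ux); exact: open_nbhs_nbhs.
Qed.

(** Inside [cimg c], the image of [A] is its preimage under [cinv c], which is continuous there. *)
Lemma chart_image_open (T : topologicalType) n (c : chart R T n) (A : set T) :
  open A -> A `<=` cdom c -> open (cfun c @` A).
Proof.
move=> oA Ac.
have -> : cfun c @` A = cimg c `&` cinv c @^-1` A.
  apply/seteqP; split=> [_ [x Ax <-]|_ [[x cx <-] /= Ax]].
    by split; [exists x => //; exact: Ac|rewrite /= cfunK//; exact: Ac].
  by exists x => //; rewrite -(cfunK cx).
apply: open_setI_preimage => //; first exact: cimg_open.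
by move=> v; exact: cinv_continuous.
Qed.

Section chart_domains.
Context {M N : manifold R}.
Implicit Types (U : set M) (f : M -> N).

(** Local expressions live on such sets, and the C^k calculus works on open domains. *)
Lemma smooth_dom_open U f (c : chart R M (mdim (mstruct M))) (V : set N) :
  open U -> (forall x, U x -> {for x, continuous f}) -> open V ->
  open (cfun c @` (U `&` cdom c `&` f @^-1` V)).
Proof.
move=> oU cf oV; apply: chart_image_open => [|x [[]]//].
apply: open_setI_preimage => //; first by apply: openI => //; exact: cdom_open.
by move=> x [/cf].
Qed.

Lemma smooth_onW U V f : V `<=` U -> smooth_on U f -> smooth_on V f.
Proof.
move=> VU [cf sf]; split=> [x /VU/cf//|c d ac ad k].
by apply: Ck_sub (sf c d ac ad k) => _ [x [[/VU Ux cx] dx] <-]; exists x.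
Qed.

Lemma smooth_on_local U f :
  (forall x, U x -> exists2 V, V x & smooth_on V f) -> smooth_on U f.
Proof.
move=> Uf; split=> [x /Uf[V Vx [cf _]]|c d ac ad k]; first exact: cf.
apply: Ck_local => _ [x [[/Uf[V Vx [_ sf]] cx] dx] <-].
by exists (cfun c @` (V `&` cdom c `&` f @^-1` cdom d)); [exists x|exact: sf].
Qed.

Lemma smooth_on_cst U (y : N) : open U -> smooth_on U (fun=> y).
Proof.
move=> oU; split=> [x _|c d ac ad k]; first exact: cst_continuous.
have oD := smooth_dom_open (c := c) oU (fun x _ => @cst_continuous _ _ y x)
  (cdom_open d).
by apply/(CkP _ _ oD) => j; exact: CkR_cst.
Qed.

End chart_domains.

Lemma smooth_on_id (M : manifold R) (U : set M) : smooth_on U (@id M).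
Proof.
split=> [x _|c d ac ad k]; first by [].
apply: Ck_sub (atlas_compat ac ad k) => _ [x [[_ cx] dx] <-].
by exists x.
Qed.

(** Near each point an intermediate chart [d] around [f x] factors the local expression of [g \o f];
    since [d] depends on the point, [Ck_local] glues the results. *)
Lemma smooth_on_comp (M N P : manifold R) (U : set M) (V : set N)
    (f : M -> N) (g : N -> P) :
  open U -> open V -> (forall x, U x -> V (f x)) ->
  smooth_on U f -> smooth_on V g -> smooth_on U (g \o f).
Proof.
move=> oU oV fV [cf sf] [cg sg]; split=> [x Ux|c e ac ae k].
  by apply: continuous_comp; [exact: cf|exact/cg/fV].
apply: Ck_local => _ [x [[Ux cx] ex] <-].
have [d ad dx] := atlas_cover (mstruct N) (f x).
have oVe : open (V `&` g @^-1` cdom e).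
  by apply: open_setI_preimage => //; exact: cdom_open.
have oD := smooth_dom_open (c := c) oU cf (openI (cdom_open d) oVe).
have oE := smooth_dom_open (c := d) oV cg (cdom_open e).
exists (cfun c @` (U `&` cdom c `&`
    f @^-1` (cdom d `&` (V `&` g @^-1` cdom e)))).
  by exists x => //; split=> //; split=> //; split=> //; exact: fV.
apply: (@Ck_ext _ _ _ _ _ (local_expr d e g \o local_expr c d f)) => //.
  move=> _ [z [[Uz cz] [dz [Vz ez]]] <-].
  by rewrite /local_expr /= cfunK// cfunK.
apply: (Ck_comp oD oE) (sg d e ad ae k) _.
  move=> _ [z [[Uz cz] [dz [Vz ez]]] <-]; exists (f z) => //.
  by rewrite /local_expr /= cfunK.
apply: Ck_sub (sf c d ac ad k) => _ [z [[Uz cz] [dz [Vz ez]]] <-].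
by exists z.
Qed.

Lemma smooth_on_pair (M N P : manifold R) (U : set M) (f : M -> N)
    (g : M -> P) :
  open U -> smooth_on U f -> smooth_on U g ->
  @smooth_on R M (prod_manifold N P) U (fun x => (f x, g x)).
Proof.
move=> oU [cf sf] [cg sg].
have cfg x : U x -> {for x, continuous (fun x => (f x, g x))}.
  by move=> Ux; apply: continuous_pair; [exact: cf|exact: cg].
split=> [//|c _ ac [d ad [e ae <-]] k].
have oD := @smooth_dom_open M (prod_manifold N P) _ _ c _ oU cfg
  (cdom_open (prod_chart d e)).
apply/(CkP _ _ oD) => j.
have cl : Ck k (cfun c @` (U `&` cdom c `&`
    (fun x => (f x, g x)) @^-1` cdom (prod_chart d e))) (local_expr c d f).
  apply: Ck_sub (sf c d ac ad k) => _ [x [[Ux cx] [/= dx ex]] <-].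
  by exists x.
have cr : Ck k (cfun c @` (U `&` cdom c `&`
    (fun x => (f x, g x)) @^-1` cdom (prod_chart d e))) (local_expr c e g).
  apply: Ck_sub (sg c e ac ae k) => _ [x [[Ux cx] [/= dx ex]] <-].
  by exists x.
case: (split_ordP j) => i ->.
  apply: (CkR_ext oD) ((CkP _ _ oD).1 cl i) => v _.
  by rewrite /local_expr /= row_mxEl.
apply: (CkR_ext oD) ((CkP _ _ oD).1 cr i) => v _.
by rewrite /local_expr /= row_mxEr.
Qed.

(** In charts this is a transition map of [M] after the linear projection [lsubmx]. *)
Lemma smooth_fst (M N : manifold R) : @smooth R (prod_manifold M N) M fst.
Proof.
split=> [[x y] _|_ d [c1 ac1 [c2 ac2 <-]] ad k]; first exact: cvg_fst.
have H := Ck_linr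
  (@continuous_lsubmx R 1 (mdim (mstruct M)) (mdim (mstruct N)))
  (@transition_dom_open _ _ _ c1 d) (atlas_compat ac1 ad k).
change (Ck k (cfun (prod_chart c1 c2) @`
    (setT `&` cdom (prod_chart c1 c2) `&` fst @^-1` cdom d))
  ((cfun d \o cinv c1) \o @lsubmx R 1 _ _)).
apply: Ck_sub H => _ [[x y] [[_ [/= cx cy]] /= dx] <-].
by rewrite /= row_mxKl; exists x.
Qed.

Lemma smooth_snd (M N : manifold R) : @smooth R (prod_manifold M N) N snd.
Proof.
split=> [[x y] _|_ d [c1 ac1 [c2 ac2 <-]] ad k]; first exact: cvg_snd.
have H := Ck_linr
  (@continuous_rsubmx R 1 (mdim (mstruct M)) (mdim (mstruct N)))
  (@transition_dom_open _ _ _ c2 d) (atlas_compat ac2 ad k).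
change (Ck k (cfun (prod_chart c1 c2) @`
    (setT `&` cdom (prod_chart c1 c2) `&` snd @^-1` cdom d))
  ((cfun d \o cinv c2) \o @rsubmx R 1 _ _)).
apply: Ck_sub H => _ [[x y] [[_ [/= cx cy]] /= dx] <-].
by rewrite /= row_mxKr; exists y.
Qed.

(** The Euclidean section of one local expression, carried back through the two charts. *)
Lemma submersion_section (M N : manifold R) (f : M -> N) (x0 : M) :
  submersion f -> exists (V : set N) (g : N -> M),
    [/\ open V, V (f x0), smooth_on V g & forall y, V y -> f (g y) = y].
Proof.
move=> [[cf sf] df_surj].
have [c ac cx0] := atlas_cover (mstruct M) x0.
have [d ad dx0] := atlas_cover (mstruct N) (f x0).
have oD := smooth_dom_open (c := c) openT cf (cdom_open d).
have Dx0 : (cfun c @` (setT `&` cdom c `&` f @^-1` cdom d)) (cfun c x0).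
  by exists x0.
have [V' [g' [oV' V'x0 cg' g'V]]] :=
  submersion_local_section oD Dx0 (sf c d ac ad) (df_surj x0 c d ac ad cx0 dx0).
pose V := cdom d `&` cfun d @^-1` V'.
have oV : open V.
  apply: open_setI_preimage => //; first exact: cdom_open.
  by move=> y; exact: cfun_continuous.
pose g := cinv c \o g' \o cfun d.
have gV y : V y ->
    [/\ cdom c (g y), cfun c (g y) = g' (cfun d y) & f (g y) = y].
  move=> [dy /g'V[[x [[_ cx] dx] xE]]].
  rewrite /g /= -xE /local_expr /= cfunK// => fxE; split=> //.
  by rewrite -(cfunK dx) fxE cfunK.
have cg y : V y -> {for y, continuous g}.
  move=> Vy; have [cy cyE _] := gV y Vy; case: Vy => dy V'y.
  apply: (@continuous_comp _ _ _ (cfun d) (cinv c \o g')).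
    exact: cfun_continuous.
  apply: (@continuous_comp _ _ _ g' (cinv c)); first exact: (cg' 0%N).
  by apply: cinv_continuous; exists (g y).
exists V, g; split=> //.
- by split=> //=; move: V'x0; rewrite /local_expr /= cfunK.
- split=> // d' c' ad' ac' k.
  have oE := smooth_dom_open (c := d') oV cg (cdom_open c').
  have oT1 := @transition_dom_open _ _ _ d' d.
  have oT2 := @transition_dom_open _ _ _ c c'.
  (* In arbitrary charts, [g] reads as the Euclidean section [g'] between two transition maps. *)
  apply: (@Ck_ext _ _ _ _ _
    ((cfun c' \o cinv c) \o (g' \o (cfun d \o cinv d')))) => //.
  apply: (Ck_comp oE oT2) (atlas_compat ac ac' k) _.
    move=> _ [y [[Vy d'y] /= c'y] <-] /=; rewrite cfunK//.
    by have [cy <- _] := gV y Vy; exists (g y).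
  apply: (Ck_comp oE oV') (cg' k) _.
    by move=> _ [y [[[dy V'y] d'y] _] <-] /=; rewrite cfunK.
  apply: Ck_sub (atlas_compat ad' ad k) => _ [y [[[dy _] d'y] _] <-].
  by exists y.
- by move=> y /gV[].
Qed.

Lemma smooth_on_ext (M N : manifold R) (U : set M) (f g : M -> N) :
  open U -> (forall x, U x -> f x = g x) -> smooth_on U f -> smooth_on U g.
Proof.
move=> oU fg [cf sf]; split=> [x Ux|c d ac ad k].
  change (g @ x --> g x); rewrite -fg//.
  apply: cvg_trans (cf x Ux).
  apply: (@near_eq_cvg _ _ (nbhs x) (nbhs_filter x)).
  by apply: filterS (open_nbhs_nbhs (conj oU Ux)) => y Uy; exact: fg.
have -> : U `&` cdom c `&` g @^-1` cdom d = U `&` cdom c `&` f @^-1` cdom d.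
  by apply/seteqP; split=> x [[Ux cx] /= dx]; split=> //=; rewrite ?fg// -fg.
have oD := smooth_dom_open (c := c) oU cf (cdom_open d).
apply: (Ck_ext oD) (sf c d ac ad k) => _ [x [[Ux cx] dx] <-].
by rewrite /local_expr /= cfunK// fg.
Qed.

Lemma smooth_comp_on (M N P : manifold R) (U : set M) (f : M -> N)
    (g : N -> P) :
  open U -> smooth g -> smooth_on U f -> smooth_on U (g \o f).
Proof. by move=> oU sg sf; apply: (smooth_on_comp oU openT) sg. Qed.

End smooth_manifold_maps.

(** * Principal bundles and sections of the associated bundle *)

Section principal_bundle.
Context {R : realType} {G : lieGroup R} {X B : manifold R}.
Variable P : principalBundle G X B.
Local Notation p := (pbproj P).

(** For a trivialization psi over [U], [sigma b = psi (b, 1)] and [tau] is the [G]-coordinate of the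
    inverse of psi. Equivariance of psi makes [tau] equivariant and recovers the group element
    between two points of a fiber. *)
Lemma pb_local_coordinates b0 :
  exists (U : set B) (sigma : B -> X) (tau : X -> G),
  [/\ open U /\ U b0,
      smooth_on U sigma /\ forall b, U b -> p (sigma b) = b,
      @smooth_on R X (lg_manifold G) (p @^-1` U) tau,
      forall x g, U (p x) -> tau (pbact P x g) = (tau x * g)%g &
      forall x y, U (p x) -> p y = p x ->
        y = pbact P x ((tau x)^-1 * tau y)%g].
Proof.
have [i _ Ui] : (\bigcup_i pbcover P i) b0 by rewrite pbcoverT.
have [t [tK Kt st st']] := pbtriv_diffeo P i.
have oU := pbcover_open (p := P) i.
have opU : open (p @^-1` pbcover P i).
  by apply: open_comp => // x _; exact: (pbproj_smooth P).1.
have oUG : open (pbcover P i `*` [set: G]).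
  rewrite openE => -[b g] [/= Ub _]; exists (pbcover P i, setT) => //=.
  by split; [exact: open_nbhs_nbhs|exact: filterT].
(* The [B]-coordinate of [t x] is [p x], since the trivialization lies over the projection. *)
have tE x : pbcover P i (p x) -> x = pbtriv P i (p x, (t x).2).
  move=> Ux; have [[Utx _] tx] := Kt x Ux.
  rewrite -{1}tx; congr (pbtriv P i _); rewrite -{2}tx.
  by case: (t x) Utx {tx} => b g /= Ub; rewrite pbtriv_proj.
have t_act x g : pbcover P i (p x) -> (t (pbact P x g)).2 = ((t x).2 * g)%g.
  move=> Ux; rewrite {1}(tE x Ux) -pbtriv_act//.
  by have [_ ->] := tK (p x, (t x).2 * g)%g (conj Ux I).
exists (pbcover P i), (fun b => pbtriv P i (b, 1%g)), (fun x => (t x).2).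
split=> //.
- split=> [|b Ub]; last by rewrite pbtriv_proj.
  apply: (@smooth_on_comp R B (prod_manifold B (lg_manifold G)) X _ _
    (fun b => (b, 1%g)) _ oU oUG _ _ st) => [b Ub //|].
  apply: smooth_on_pair => //; first exact: smooth_on_id.
  exact: smooth_on_cst.
- by apply: (smooth_comp_on opU) st'; exact: smooth_snd.
move=> x y Ux yx; have Uy : pbcover P i (p y) by rewrite yx.
by rewrite {1}(tE x Ux) -pbtriv_act// mulVKg -yx -tE.
Qed.

Lemma pb_same_fiber x y : p y = p x -> exists g, y = pbact P x g.
Proof.
have [U [_ [tau [[_ Ux] _ _ _ fib]]]] := pb_local_coordinates (p x).
by move=> /(fib x y Ux) E; eexists; exact: E.
Qed.

Lemma pb_free x g : pbact P x g = x -> g = 1%g.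
Proof.
have [U [_ [tau [[_ Ux] _ _ tauM _]]]] := pb_local_coordinates (p x).
by move=> /(congr1 tau); rewrite tauM// => /(canRL (mulKg _)); rewrite mulVg.
Qed.

End principal_bundle.

(** * Sections of the associated bundle and equivariant maps *)

Section cross_sections.
Context {R : realType} {G : lieGroup R} {X B F : manifold R}.
Variables (P : principalBundle G X B) (a : leftAction G F).
Variable (E : assocBundle P a).
Local Notation p := (pbproj P).

Lemma Gorbit_act x y g : Gorbit P a (pbact P x g, y) = Gorbit P a (x, a g y).
Proof.
apply/esym/GorbitP; exists g; rewrite /diag_act /=.
by rewrite -lactM mulVg lact1.
Qed.

Lemma Gorbit_injr x : injective (fun y => Gorbit P a (x, y)).
Proof.
move=> y y' /GorbitP[g [/esym/pb_free -> ->]].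
by rewrite invg1 lact1.
Qed.

(** A representative of [e] has the form [(x g, y)], and [Gorbit_act] moves [g] to the second
    factor. *)
Lemma Gorbit_fiber x e : assoc_proj e = p x ->
  exists y, e = Gorbit P a (x, y).
Proof.
have [[u y] <-] := Gorbit_surj e; rewrite assoc_projE.
by move=> /pb_same_fiber[g ->]; exists (a g y); exact: Gorbit_act.
Qed.

Lemma Gorbit_smooth :
  @smooth R (prod_manifold X F) (ab_manifold E) (Gorbit P a).
Proof. exact: (ab_submersion E).1. Qed.

Lemma equivariant_Gorbit phi x x' : equivariant P a phi -> p x' = p x ->
  Gorbit P a (x', phi x') = Gorbit P a (x, phi x).
Proof.
move=> ephi /pb_same_fiber[g ->].
by rewrite Gorbit_act ephi -lactM mulgV lact1.
Qed.

Lemma section_of_equivariant (phi : X -> F) :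
  smooth phi -> equivariant P a phi ->
  exists s : B -> ab_manifold E,
    [/\ smooth s, cross_section s & forall x, s (p x) = Gorbit P a (x, phi x)].
Proof.
move=> sphi ephi.
(* [r] is a bare choice of a point in each fiber, without continuity; by [sE] the section does not
   depend on it. *)
have /choice[r rE] := pbproj_surj P.
pose s b : ab_manifold E := Gorbit P a (r b, phi (r b)).
have sE x : s (p x) = Gorbit P a (x, phi x) by apply: equivariant_Gorbit.
exists s; split=> // [|b]; last by rewrite assoc_projE.
apply: smooth_on_local => b _.
have [U [sigma [_ [[oU Ub] [ssigma sigmaK] _ _ _]]]] :=
  pb_local_coordinates P b.
exists U => //.
(* Over [U] the choice [r] is replaced by the smooth local section [sigma]. *)
apply: (@smooth_on_ext _ _ _ _
  (fun b => Gorbit P a (sigma b, phi (sigma b)) : ab_manifold E)) => //.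
  by move=> c Uc; rewrite -sE sigmaK.
apply: (@smooth_comp_on R B (prod_manifold X F) (ab_manifold E) U
  (fun b => (sigma b, phi (sigma b))) _ oU Gorbit_smooth).
by apply: smooth_on_pair => //; exact: (smooth_comp_on oU sphi ssigma).
Qed.

Lemma equivariant_of_section (s : B -> ab_manifold E) :
  smooth s -> cross_section s ->
  exists phi : X -> F, [/\ smooth phi, equivariant P a phi &
    forall x, s (p x) = Gorbit P a (x, phi x)].
Proof.
move=> ss cs.
have /choice[phi phiE] x : exists y, s (p x) = Gorbit P a (x, y).
  by apply: Gorbit_fiber; exact: cs.
exists phi; split=> // [|x g]; last first.
  (* Both sides give the orbit [s (p x)] when paired with [x g]. *)
  apply: (@Gorbit_injr (pbact P x g)); rewrite -phiE pbproj_act phiE.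
  by rewrite Gorbit_act -lactM mulgV lact1.
apply: smooth_on_local => x0 _.
have [U [_ [tau [[oU Ux0] _ stau _ fib]]]] := pb_local_coordinates P (p x0).
have [z0 z0E] := Gorbit_surj (s (p x0)).
have [V [gamma [oV Vz0 sgamma gammaK]]] :=
  @submersion_section R (prod_manifold X F) _ _ z0 (ab_submersion E).
have sp : smooth p := pbproj_smooth P.
have ssp : @smooth R X (ab_manifold E) (s \o p).
  exact: (smooth_comp_on openT).
(* The points where both [tau] and the local section [gamma] of the quotient map are available. *)
pose O := p @^-1` U `&` (s \o p) @^-1` V.
have opU : open (p @^-1` U) by apply: open_comp => // x _; exact: sp.1.
have oO : open O.
  by apply: openI => //; apply: open_comp => // x _; exact: ssp.1.
exists O; first by split=> //=; rewrite -z0E.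
pose u x := (gamma (s (p x))).1; pose y x := (gamma (s (p x))).2.
have uyE x : O x -> Gorbit P a (u x, y x) = s (p x).
  by move=> [_ Vx]; rewrite /u /y -surjective_pairing gammaK.
have pu x : O x -> p (u x) = p x.
  by move=> /uyE uE; rewrite -[RHS]cs -uE assoc_projE.
apply: (@smooth_on_ext _ _ _ _
  (fun x => a ((tau x)^-1 * tau (u x))%g (y x))) => //.
  (* [fib] writes [u x] as a translate of [x], and [Gorbit_act] transfers the translation to
     [y x]. *)
  move=> x Ox; apply: (@Gorbit_injr x); rewrite -phiE -uyE//.
  by rewrite [in RHS](fib x (u x) Ox.1 (pu x Ox)) Gorbit_act.
have sgO : @smooth_on R X (prod_manifold X F) O (fun x => gamma (s (p x))).
  apply: (smooth_on_comp oO oV) sgamma; first by move=> x [].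
  exact: smooth_onW ssp.
have su : smooth_on O u by exact: (smooth_comp_on oO (@smooth_fst _ X F)).
have sy : smooth_on O y by exact: (smooth_comp_on oO (@smooth_snd _ X F)).
have stx : @smooth_on R X (lg_manifold G) O tau.
  by apply: smooth_onW stau => x [].
have stu : @smooth_on R X (lg_manifold G) O (tau \o u).
  by apply: (smooth_on_comp oO opU) stau => // x Ox; rewrite /= pu//; case: Ox.
have stV := smooth_comp_on oO (@lg_inv_smooth R G) stx.
have sg := smooth_comp_on oO (@lg_mul_smooth R G) (smooth_on_pair oO stV stu).
exact: (smooth_comp_on oO (lact_smooth a) (smooth_on_pair oO sg sy)).
Qed.

End cross_sections.

(** Proof irrelevance; it reduces the two cancellations to equalities of underlying maps. *)
Lemma sval_inj (T : Type) (Q : T -> Prop) : injective (@sval T Q).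
Proof.
move=> [x Qx] [y Qy] /= xy; case: y / xy Qy => Qx'.
by rewrite (Prop_irrelevance Qx Qx').
Qed.

Theorem theorem6p4 (R : realType) (G : lieGroup R) (X B F : manifold R)
    (P : principalBundle G X B) (a : leftAction G F) (E : assocBundle P a) :
  exists (sec : {phi : X -> F | smooth phi /\ equivariant P a phi} ->
                {s : B -> ab_manifold E | smooth s /\ cross_section s})
         (eqv : {s : B -> ab_manifold E | smooth s /\ cross_section s} ->
                {phi : X -> F | smooth phi /\ equivariant P a phi}),
    [/\ cancel sec eqv,
        cancel eqv sec,
        (* [sec phi] is the only map [s] with [s (p x) = (x, phi x) G] *)
        forall phi (s : B -> ab_manifold E),
          (forall x, s (pbproj P x) = Gorbit P a (x, sval phi x)) <->
          s = sval (sec phi) &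
        (* [eqv s] is the only map [phi] with [s (p x) = (x, phi x) G] *)
        forall s (phi : X -> F),
          (forall x, sval s (pbproj P x) = Gorbit P a (x, phi x)) <->
          phi = sval (eqv s)].
Proof.
have /choice[sec secE]
    (phi : {phi : X -> F | smooth phi /\ equivariant P a phi}) :
    exists s : {s : B -> ab_manifold E | smooth s /\ cross_section s},
      forall x, sval s (pbproj P x) = Gorbit P a (x, sval phi x).
  case: phi => phi [sphi ephi].
  have [s [ss cs sE]] := section_of_equivariant E sphi ephi.
  by exists (exist _ s (conj ss cs)).
have /choice[eqv eqvE]
    (s : {s : B -> ab_manifold E | smooth s /\ cross_section s}) :
    exists phi : {phi : X -> F | smooth phi /\ equivariant P a phi},
      forall x, sval s (pbproj P x) = Gorbit P a (x, sval phi x).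
  case: s => s [ss cs].
  have [phi [sphi ephi phiE]] := equivariant_of_section ss cs.
  by exists (exist _ phi (conj sphi ephi)).
(* Uniqueness of [s] comes from surjectivity of the projection. *)
have sec_uniq phi (s : B -> ab_manifold E) :
    (forall x, s (pbproj P x) = Gorbit P a (x, sval phi x)) <->
    s = sval (sec phi).
  split=> [sE|-> //]; apply/funext => b.
  by have [x <-] := pbproj_surj P b; rewrite sE secE.
(* Uniqueness of [phi] comes from freeness of the action, through [Gorbit_injr]. *)
have eqv_uniq s (phi : X -> F) :
    (forall x, sval s (pbproj P x) = Gorbit P a (x, phi x)) <->
    phi = sval (eqv s).
  split=> [phiE|-> //]; apply/funext => x.
  by apply: (@Gorbit_injr _ _ _ _ _ P a x); rewrite -phiE -eqvE.
(* Both assignments are characterized by the same relation between [s] and [phi], so uniqueness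
   makes them mutually inverse. *)
exists sec, eqv; split=> // [phi|s].
  by apply/sval_inj/esym; apply/eqv_uniq.
by apply/sval_inj/esym; apply/sec_uniq.
Qed.
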